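(* Fix an integer $k\ge 3$ and let $n\ge k$. Let the edges of the complete graph $K_n$ be given independent uniform $[0,1]$ edge weights, and let $W$ denote the minimum weight of a clique $K_k$ in $K_n$. For $z\ge 0$ let $$w=\frac{z}{n^{2/(k-1)}}\qquad\text{and}\qquad \lambda=\binom{n}{k}\frac{w^{\binom k2}}{\binom k2!}$$ (so that $\lambda\sim \frac{z^{\binom k2}}{k!\,\binom k2!}$ as $n\to\infty$). Then, for $$z\le \min\left\{n^{1/\binom k2},\; n^{2/(k-1)}\exp\left(-\tfrac{k-1}{k-2}\right)\right\}$$ (equivalently, $w\le\min\{n^{-2/k},\exp(-\frac{k-1}{k-2})\}$), $$\left|\Pr\left(W\ge w=\frac{z}{n^{2/(k-1)}}\right)-\exp(-\lambda)\right|\le \frac87\cdot\frac{k-2}{\binom k2!\,\big((k-1)!\big)^2}\cdot\frac{z^{\binom k2+k-1}}{n}.$$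
   Context: The weight of a clique is the sum of the weights of its edges. $\binom k2!$ means $\left(\binom k2\right)!$. $f\sim g$ means $f/g\to1$ as $n\to\infty$. *)

(* Defs.v *)
From HB Require Import structures.
From mathcomp Require Import all_boot all_order all_algebra.
From mathcomp Require Import all_classical all_reals all_analysis.
Set Implicit Arguments.
Unset Strict Implicit.
Unset Printing Implicit Defensive.
Import Order.TTheory GRing.Theory Num.Theory.
Import numFieldNormedType.Exports.
Local Open Scope classical_set_scope.
Local Open Scope ring_scope.

Definition edge (n : nat) : Type := {e : {set 'I_n} | #|e| == 2%N}.
HB.instance Definition _ (n : nat) := Finite.on (edge n).

(* A clique of K_n is given by its vertex set S; its edges are the 2-subsets
   of S. *)
Definition clique_weight (R : realType) (n : nat) (x : edge n -> R)
    (S : {set 'I_n}) : R :=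
  \sum_(e : edge n | val e \subset S) x e.

(* The value is +oo when there is no k-clique, i.e. when n < k; for k <= n the
   minimum is attained and finite. *)
Definition min_clique_weight (R : realType) (n k : nat) (x : edge n -> R)
    : \bar R :=
  \big[Order.min/+oo%E]_(S : {set 'I_n} | #|S| == k) (clique_weight x S)%:E.

Definition mutually_independent (d : measure_display) (T : measurableType d)
    (R : realType) (P : probability T R) (I : finType)
    (X : I -> {RV P >-> R}) : Prop :=
  forall (J : {set I}) (B : I -> set R),
    (forall i, i \in J -> measurable (B i)) ->
    P (\bigcap_(i in [set` J]) (X i @^-1` B i)) =
    (\prod_(i in J) P (X i @^-1` B i))%E.

Definition uniform01 (d : measure_display) (T : measurableType d)
    (R : realType) (P : probability T R) (Y : {RV P >-> R}) : Prop :=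
  forall B : set R, measurable B ->
    distribution P Y B = uniform_prob (@ltr01 R) B.

Definition threshold (R : realType) (n k : nat) (z : R) : R :=
  z / n%:R `^ (2%:R / (k%:R - 1)).

Definition lambda (R : realType) (n k : nat) (z : R) : R :=
  'C(n, k)%:R * threshold n k z ^+ 'C(k, 2) / ('C(k, 2)`!)%:R.

(* Main.v *)
Require Import Defs.
From HB Require Import structures.
From mathcomp Require Import all_boot all_order all_algebra.
From mathcomp Require Import all_classical all_reals all_analysis.
From mathcomp Require Import ring lra zify.
Import Order.TTheory GRing.Theory Num.Theory.
Import numFieldNormedType.Exports.
Set Implicit Arguments.
Unset Strict Implicit.
Unset Printing Implicit Defensive.
Local Open Scope classical_set_scope.
Local Open Scope ring_scope.

(* Call a k-clique light when its weight is below w, so that W >= w means that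
   no clique is light. A sum of j independent uniform variables is below
   w <= 1 with probability w^j / j!, hence lambda is the expected number of
   light cliques. Cliques sharing at most one vertex have no common edge and
   are independent, so the Chen-Stein method bounds the error by
   sum p_S p_U + sum P(S and U are light) over the pairs that share l >= 2
   vertices. The second probability is at most the product of p_S and the
   probability that the edges of U outside S have total weight below w. Since
   n w^(k/2) <= 1, each l contributes to the second sum at most what l = k - 1
   does, which yields the factor k - 2. The first sum is smaller by a factor of
   order w, and w <= 1/e < 27/70 turns it into the constant 8/7. *)

(** * The Stein equation of the Poisson law *)

Lemma factM_le (a b : nat) : (a`! * b`! <= (a + b)`!)%N.
Proof.
rewrite -(bin_fact (leq_addr b a)) addKn mulnC.
by rewrite leq_pmull // bin_gt0 leq_addr.
Qed.

Section SteinSolution.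
Context {R : realType}.
Implicit Types (x : R) (j n : nat).

Definition exp_psum x j : R := \sum_(i < j) x ^+ i / i`!%:R.

Lemma exp_psumE x : exp_psum x = series (exp_coeff x).
Proof.
apply/funext => j; rewrite /series /= big_mkord /exp_psum.
by apply: eq_bigr => i _; rewrite /exp_coeff.
Qed.

Lemma exp_psum_cvg x : exp_psum x n @[n --> \oo] --> expR x.
Proof. by rewrite exp_psumE; apply: is_cvg_series_exp_coeff. Qed.

Lemma exp_psum_le x j : 0 <= x -> exp_psum x j <= expR x.
Proof.
move=> x0; have := @exp_psum_cvg x => /cvg_lim <- //.
apply: nondecreasing_cvgn_le; last by apply/cvg_ex; exists (expR x); exact: exp_psum_cvg.
apply/nondecreasing_seqP => n; rewrite /exp_psum big_ord_recr /= lerDl.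
by rewrite divr_ge0 ?exprn_ge0.
Qed.

(** Termwise from [factM_le]. The denominator [j!] is chosen to cancel the factorial in
    [stein x j.+1]. *)
Lemma exp_psum_tail x j n : 0 <= x ->
  exp_psum x (j.+1 + n) <= exp_psum x j.+1 + x ^+ j.+1 / j`!%:R * exp_psum x n.
Proof.
move=> x0; rewrite /exp_psum big_split_ord /= lerD2l mulr_sumr ler_sum// => i _.
rewrite exprD -!mulrA ler_wpM2l ?exprn_ge0// mulrCA ler_wpM2l ?exprn_ge0//.
rewrite -invfM lef_pV2 ?posrE ?mulr_gt0 ?ltr0n ?fact_gt0// -natrM ler_nat.
by rewrite (leq_trans (factM_le _ _))// leq_fact// leq_add2r.
Qed.

Lemma exp_tail_le x j : 0 <= x ->
  expR x - exp_psum x j.+1 <= x ^+ j.+1 / j`!%:R * expR x.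
Proof.
move=> x0; rewrite lerBlDl.
have cv := @exp_psum_cvg x; rewrite -(cvg_shiftn j.+1) in cv.
rewrite -[leLHS](cvg_lim _ cv)//; apply: limr_le; first by apply/cvg_ex; exists (expR x).
near=> n => /=; rewrite addnC (le_trans (exp_psum_tail _ _ x0))// lerD2l.
by rewrite ler_wpM2l ?divr_ge0 ?exprn_ge0 ?exp_psum_le.
Unshelve. all: by end_near. Qed.

(* Only the values at [j > 0] matter: in [stein_eq] the value at [0] is
   multiplied by [0]. *)
Definition stein x j : R :=
  expR (- x) * (j.-1)`!%:R / x ^+ j * (expR x - exp_psum x j).

(** The right side is the indicator of 0 minus its mean under the Poisson law of mean [x]. Averaging
    over a random count therefore compares its chance of being 0 with [expR (- x)]. *)
Lemma stein_eq x j : 0 < x ->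
  x * stein x j.+1 - j%:R * stein x j = (j == 0)%:R - expR (- x).
Proof.
move=> x0; have xn0 : x != 0 by rewrite gt_eqF.
have e1 : expR (- x) * expR x = 1 by rewrite -expRD addNr expR0.
rewrite /stein /=; case: j => [|j] /=.
  rewrite /exp_psum big_ord_recl big_ord0 /= expr0 fact0 mul0r subr0 addr0.
  by rewrite divr1 expr1; field: e1.
rewrite /exp_psum [in X in X - _]big_ord_recr /= -/(exp_psum x j.+1) factS natrM.
set S := exp_psum x j.+1; set a := expR (-x); set b := expR x in e1 *.
have fn0 : j`!%:R != 0 :> R by rewrite pnatr_eq0 -lt0n fact_gt0.
have jn0 : 1 + j%:R != 0 :> R by rewrite nat1r pnatr_eq0.
by rewrite (exprS _ j.+1) -natr1; field; rewrite expf_neq0// xn0 fn0 addrC jn0.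
Qed.

Lemma stein_ge0 x j : 0 < x -> 0 <= stein x j.
Proof.
move=> x0; rewrite mulr_ge0 ?subr_ge0 ?exp_psum_le ?(ltW x0)//.
by rewrite divr_ge0 ?mulr_ge0 ?expR_ge0 ?exprn_ge0// ltW.
Qed.

Lemma stein_le1 x j : 0 < x -> stein x j.+1 <= 1.
Proof.
move=> x0; have e1 : expR (- x) * expR x = 1 by rewrite -expRD addNr expR0.
have xn0 : x != 0 by rewrite gt_eqF.
have fn0 : j`!%:R != 0 :> R by rewrite pnatr_eq0 -lt0n fact_gt0.
rewrite /stein /=; apply: le_trans (ler_wpM2l _ (exp_tail_le j (ltW x0))) _.
  by rewrite divr_ge0 ?mulr_ge0 ?expR_ge0 ?exprn_ge0// ltW.
rewrite le_eqVlt; apply/orP; left; apply/eqP; rewrite -[RHS]e1.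
by field; rewrite ?expf_neq0 ?xn0 ?fn0.
Qed.

(** The values at positive arguments lie in [0, 1], which gives a crude bound by 1 in place of a
    Lipschitz estimate. *)
Lemma stein_dist x i j : 0 < x -> `|stein x i.+1 - stein x j.+1| <= (i != j)%:R.
Proof.
move=> x0; case: eqP => [->|_]; first by rewrite subrr normr0.
have := stein_ge0 i.+1 x0; have := stein_ge0 j.+1 x0.
have := stein_le1 i x0; have := stein_le1 j x0.
rewrite /= ler_norml; lra.
Qed.

End SteinSolution.

(** * The Chen-Stein inequality *)

Section ChenStein.
Context {R : realType} {I : finType}.
(** [q] is the law of the random set of indices whose events occur, and [N i] is a dependency
    neighbourhood. Working with this law keeps the argument within finite sums. *)
Variables (q : {set I} -> R) (N : I -> {set I}).
Hypothesis q_ge0 : forall A, 0 <= q A.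
Hypothesis q_sum1 : \sum_A q A = 1.
Hypothesis N_refl : forall i, i \in N i.

Let p i := \sum_(A : {set I} | i \in A) q A.

Hypothesis q_indep : forall i (B : {set I}),
  \sum_(A : {set I} | (i \in A) && (A :\: N i == B)) q A =
  p i * \sum_(A : {set I} | A :\: N i == B) q A.

(** Grouping the sets by the value of [A :\: N i] extends [q_indep] to every function of that
    value. *)
Lemma indep_mean i (h : {set I} -> R) :
  \sum_(A : {set I} | i \in A) q A * h (A :\: N i) =
  p i * \sum_(A : {set I}) q A * h (A :\: N i).
Proof.
rewrite (partition_big (fun A => A :\: N i) xpredT)//= mulr_sumr.
rewrite [RHS](eq_bigr (fun A => p i * (q A * h (A :\: N i))))//.
rewrite [RHS](partition_big (fun A => A :\: N i) xpredT)//=.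
apply: eq_bigr => B _.
rewrite (eq_bigr (fun A => q A * h B)); last by move=> A /andP[_ /eqP->].
rewrite -mulr_suml q_indep -mulrA -mulr_sumr; congr (_ * _); rewrite mulr_suml.
by apply: eq_bigr => A /eqP->.
Qed.

Lemma mean_natmul (S : {set I}) (E : pred {set I}) :
  \sum_(A : {set I} | E A) q A * (\sum_(j in S) (j \in A)%:R) =
  \sum_(j in S) \sum_(A : {set I} | E A && (j \in A)) q A.
Proof.
under eq_bigr do rewrite mulr_sumr.
rewrite exchange_big /=; apply: eq_bigr => j _; rewrite big_mkcondr /=.
by apply: eq_bigr => A _; case: (j \in A); rewrite ?mulr1 ?mulr0.
Qed.

(** Average the Stein equation at [#|A|] and split it over [i]. Both [f #|A|.+1] and, when
    [i \in A], [f #|A|] are compared with [h (A :\: N i)], whose two contributions cancel by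
    independence. The values differ only if [A] meets [N i], respectively [N i :\ i], and the number
    of common elements bounds that indicator. *)
Lemma chen_stein :
  `|q finset.set0 - expR (- \sum_i p i)| <=
  \sum_i \sum_(j in N i) p i * p j +
  \sum_i \sum_(j in N i :\ i)
     \sum_(A : {set I} | (i \in A) && (j \in A)) q A.
Proof.
have p_ge0 i : 0 <= p i by rewrite sumr_ge0.
have rhs_ge0 : 0 <= \sum_i \sum_(j in N i) p i * p j +
  \sum_i \sum_(j in N i :\ i) \sum_(A : {set I} | (i \in A) && (j \in A)) q A.
  by rewrite addr_ge0// sumr_ge0// => i _; rewrite sumr_ge0// => j _;
     rewrite ?mulr_ge0// sumr_ge0.
set x := \sum_i p i.
have : 0 <= x by rewrite sumr_ge0.
rewrite le_eqVlt => /orP[/eqP x0|x0].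
  (* The Stein equation requires a positive mean; for mean 0 the empty set has full mass. *)
  have pi0 i : p i = 0.
    by have /psumr_eq0P := esym x0; apply.
  suff -> : q finset.set0 = 1 by rewrite -x0 oppr0 expR0 subrr normr0.
  rewrite -q_sum1 (bigD1 finset.set0)//= big1 ?addr0// => A /finset.set0Pn[i iA].
  by have /psumr_eq0P := pi0 i; apply.
pose f j := stein x j.
have xf (A : {set I}) : (A == finset.set0)%:R - expR (- x) =
    \sum_i (p i * f #|A|.+1 - (i \in A)%:R * f #|A|).
  rewrite sumrB -mulr_suml -/x -mulr_suml -natr_sum.
  have -> : (\sum_i (i \in A))%N = #|A|.
    by rewrite -sum1_card [RHS]big_mkcond; apply: eq_bigr => i _; case: (i \in A).
  by rewrite stein_eq// cards_eq0.
have -> : q finset.set0 - expR (- x) = \sum_A q A * ((A == finset.set0)%:R - expR (- x)).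
  under eq_bigr do rewrite mulrBr.
  rewrite sumrB -mulr_suml q_sum1 mul1r; congr (_ - _).
  by rewrite (bigD1 finset.set0)//= eqxx mulr1 big1 ?addr0// => A /negPf->; rewrite mulr0.
under eq_bigr do rewrite xf mulr_sumr.
rewrite exchange_big -big_split /=.
apply: (le_trans (ler_norm_sum _ _ _)); apply: ler_sum => i _.
pose h (A : {set I}) := f #|A|.+1.
have -> : \sum_A q A * (p i * f #|A|.+1 - (i \in A)%:R * f #|A|) =
    p i * (\sum_A q A * (f #|A|.+1 - h (A :\: N i))) -
    \sum_(A : {set I} | i \in A) q A * (f #|A| - h (A :\: N i)).
  under [X in _ = p i * X - _]eq_bigr do rewrite mulrBr.
  under [X in _ = _ - X]eq_bigr do rewrite mulrBr.
  rewrite !sumrB mulrBr indep_mean opprB addrA subrK.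
  rewrite mulr_sumr [X in _ = _ - X]big_mkcond -sumrB; apply: eq_bigr => A _.
  by rewrite mulrBr; case: (i \in A); rewrite ?mul1r ?mul0r ?mulr0//; ring.
apply: (le_trans (ler_normB _ _)); apply: lerD.
  rewrite normrM (ger0_norm (p_ge0 i)) -mulr_sumr ler_wpM2l//.
  apply: (le_trans (ler_norm_sum _ _ _)).
  apply: (@le_trans _ _ (\sum_(A : {set I} | xpredT A) q A * (\sum_(j in N i) (j \in A)%:R))).
    apply: ler_sum => A _; rewrite normrM ger0_norm// ler_wpM2l//.
    apply: le_trans (stein_dist _ _ x0) _; case: eqP => //= neq.
      by rewrite sumr_ge0.
    have /finset.set0Pn[j /finset.setIP[jA jN]] : A :&: N i != finset.set0.
      by apply/eqP => AN0; apply: neq; rewrite -(cardsID (N i) A) AN0 cards0.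
    by rewrite (bigD1 j)//= jA lerDl sumr_ge0.
  by rewrite (mean_natmul (N i) xpredT).
apply: (le_trans (ler_norm_sum _ _ _)).
apply: (@le_trans _ _ (\sum_(A : {set I} | i \in A) q A * (\sum_(j in N i :\ i) (j \in A)%:R))).
  apply: ler_sum => A iA; rewrite normrM ger0_norm// ler_wpM2l//.
  have -> : #|A| = #|A :\ i|.+1 by rewrite (cardsD1 i A) iA.
  apply: le_trans (stein_dist _ _ x0) _; case: eqP => //= neq.
    by rewrite sumr_ge0.
  have /finset.set0Pn[j /finset.setIP[]] : (A :\ i) :&: N i != finset.set0.
    apply/eqP => AN0; apply: neq; rewrite -(cardsID (N i) (A :\ i)) AN0 cards0.
    by rewrite finset.setDDl (finset.setUidPr _) ?finset.sub1set.
  rewrite !inE => /andP[ji jA] jN.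
  by rewrite (bigD1 j) ?inE ?ji//= jA lerDl sumr_ge0.
by rewrite mean_natmul.
Qed.

End ChenStein.

(** * Independence of disjoint groups of variables *)

Section Grouping.
Context {d : measure_display} {T : measurableType d} {R : realType}.
Context {P : probability T R} {I : finType}.
Variable X : I -> {RV P >-> R}.
Implicit Types (J K : {set I}).

(** As functions of [A] the two sides are finite measures: [P] restricted to [F], and [P] scaled by
    [P F]. They agree on a pi-system containing the whole space, hence on the sigma-algebra it
    generates. *)
Lemma indep_g_sigma (G : set (set T)) (F : set T) :
  G `<=` measurable -> setI_closed G -> G setT -> measurable F ->
  (forall A, G A -> P (A `&` F) = (P A * P F)%E) ->
  forall A, <<s G >> A -> P (A `&` F) = (P A * P F)%E.
Proof.
move=> Gm GI GT mF GF A sA.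
have PF0 : 0 <= fine (P F) by rewrite fine_ge0.
have PFE : P F = (fine (P F))%:E by rewrite fineK// fin_num_measure.
pose m2 := mscale (NngNum PF0) P.
have GU : \bigcup_(k : nat) [set: T] = setT by rewrite bigcup_const//; exists 0%N.
have := @g_sigma_algebra_measure_unique d R T G Gm (fun=> setT) (fun=> GT) GU
  (mrestr P mF) m2 GI _ _ A sA.
rewrite /= /mrestr /m2 /mscale /= => -> //; first by rewrite muleC -PFE.
  by move=> B GB; rewrite /mscale /= GF// muleC -PFE.
by move=> _; rewrite setTI PFE ltry.
Qed.

(** These sets form a pi-system that generates the sigma-algebra of the variables [X i] with [i] in
    [J]. *)
Definition cylinder J : set (set T) :=
  [set A | exists2 B : I -> set R, (forall i, i \in J -> measurable (B i)) &
     A = \bigcap_(i in [set` J]) (X i @^-1` B i)].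

Lemma cylinder_measurable J : cylinder J `<=` measurable.
Proof.
move=> _ [B mB ->]; apply: fin_bigcap_measurable; first exact: finite_finset.
by move=> i iJ; rewrite -[X in measurable X]setTI; apply: measurable_funP; [|exact: mB].
Qed.

Lemma g_cylinder_measurable J : <<s cylinder J >> `<=` measurable.
Proof.
apply: smallest_sub; first exact: sigma_algebra_measurable.
exact: cylinder_measurable.
Qed.

Lemma cylinder_setI_closed J : setI_closed (cylinder J).
Proof.
move=> _ _ [B mB ->] [C mC ->]; exists (fun i => B i `&` C i).
  by move=> i iJ; apply: measurableI; [exact: mB|exact: mC].
by rewrite -bigcapI.
Qed.

Lemma cylinder_setT J : cylinder J setT.
Proof.
exists (fun=> setT) => //; apply/seteqP; split => // t _ i _; exact: Logic.I.
Qed.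

Hypothesis indX : mutually_independent X.

Lemma cylinder_indep J K A B : {in K, forall i, i \notin J} ->
  cylinder J A -> cylinder K B -> P (A `&` B) = (P A * P B)%E.
Proof.
move=> JK [a ma ->] [b mb ->].
have JnK i : i \in K -> (i \in J) = false.
  by move=> /JK/negbTE.
(* The two families of Borel sets glue along disjoint index sets, so the intersection is again a
   cylinder and mutual independence applies to all three. *)
pose c i := if i \in J then a i else b i.
have -> : \bigcap_(i in [set` J]) (X i @^-1` a i) `&`
    \bigcap_(i in [set` K]) (X i @^-1` b i) =
    \bigcap_(i in [set` J :|: K]) (X i @^-1` c i).
  apply/seteqP; split => t /=.
    move=> [tJ tK] i /=; rewrite inE /c; case: ifPn => [iJ _|_ /= iK].
      exact: tJ.
    exact: tK.
  move=> tJK; split => i /= iJ.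
    by have := tJK i; rewrite /= inE /c iJ; apply.
  by have := tJK i; rewrite /= inE /c iJ orbT JnK//; apply.
rewrite !indX//; last first.
  move=> i; rewrite inE /c; case: ifPn => [iJ _|_ /= iK]; [exact: ma|exact: mb].
rewrite big_mkcond [X in (X * _)%E]big_mkcond [X in (_ * X)%E]big_mkcond.
rewrite -big_split; apply: eq_bigr => i _; rewrite inE /c.
case: (boolP (i \in J)) => [iJ|_] /=; last by rewrite mul1e.
by case: ifPn => [iK|]; rewrite ?mule1//; rewrite JnK in iJ.
Qed.

(** Independence passes from cylinders to the generated sigma-algebras one side at a time, by
    [indep_g_sigma]. *)
Lemma grouping_indep J K A B : {in K, forall i, i \notin J} ->
  <<s cylinder J >> A -> <<s cylinder K >> B -> P (A `&` B) = (P A * P B)%E.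
Proof.
move=> JK sA sB.
have mB := g_cylinder_measurable sB.
apply: (indep_g_sigma (@cylinder_measurable J) (@cylinder_setI_closed J)
  (cylinder_setT J) mB _ sA) => C CJ.
have mC := cylinder_measurable CJ.
rewrite setIC muleC.
apply: (indep_g_sigma (@cylinder_measurable K) (@cylinder_setI_closed K)
  (cylinder_setT K) mC _ sB) => D DK.
by rewrite setIC muleC; exact: cylinder_indep CJ DK.
Qed.

Definition psum J (t : T) : R := \sum_(i in J) X i t.

Lemma psum_g_sigma J (B : set R) : measurable B ->
  <<s cylinder J >> (psum J @^-1` B).
Proof.
move=> mB.
(* Equipping [T] with the generated sigma-algebra reduces the claim to measurability of a finite
   sum. *)
pose S : measurableType _ := g_sigma_algebraType (cylinder J).
have mX i : i \in J -> measurable_fun [set: S] (X i : S -> R).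
  move=> iJ _ C mC; rewrite setTI; apply: sub_sigma_algebra.
  exists (fun j => if j == i then C else setT).
    by move=> j _; case: eqP.
  apply/seteqP; split => t /=.
    by move=> Xt j _; rewrite /preimage /=; case: eqP => [->|].
  by move=> /(_ i iJ); rewrite /preimage /= eqxx.
have mS : measurable_fun [set: S] (psum J : S -> R).
  have -> : psum J = fun t => \sum_(i <- index_enum I) (if i \in J then X i t else 0).
    by apply/funext => t; rewrite /psum big_mkcond.
  apply: (@measurable_sum _ S R setT I _ (fun i t => if i \in J then X i t else 0)) => i.
  case: (boolP (i \in J)) => [iJ|_]; first exact: mX.
  exact: measurable_cst.
by have := mS measurableT B mB; rewrite setTI.
Qed.

Lemma measurable_psum J : measurable_fun setT (psum J).
Proof.
move=> _ B mB; rewrite setTI.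
exact: g_cylinder_measurable (psum_g_sigma mB).
Qed.

End Grouping.

(** * The law of a sum of independent uniform variables *)

Section SumLaw.
Context {d : measure_display} {T : measurableType d} {R : realType}.
Context {P : probability T R} {I : finType}.
Variable X : I -> {RV P >-> R}.
Hypothesis indX : mutually_independent X.
Hypothesis unifX : forall i, uniform01 (X i).
Implicit Types (J : {set I}) (y : R).

Lemma integral_pow (r : nat) y : 0 < y ->
  (\int[lebesgue_measure]_(x in `[0%R, y]) ((y - x) ^+ r / r`!%:R)%:E)%E =
  (y ^+ r.+1 / (r.+1)`!%:R)%:E.
Proof.
move=> y0.
pose F x : R := - ((y - x) ^+ r.+1 / (r.+1)`!%:R).
have dF : forall u : R, is_derive u (1 : R) F ((y - u) ^+ r / r`!%:R).
  move=> u; rewrite /F.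
  have -> : (fun x => - ((y - x) ^+ r.+1 / (r.+1)`!%:R)) =
      (- (r.+1)`!%:R^-1) *: ((cst y - id) ^+ r.+1 : R -> R).
    by apply/funext => x; rewrite /= mulrC -mulNr; congr (_ * _); rewrite fctE.
  apply: is_derive_eq; rewrite /= sub0r !scalerN.
  rewrite fctE factS natrM.
  have -> : cst y u + (- id) u = y - u by [].
  rewrite /GRing.scale /= mulr1; field.
  by rewrite nat1r !pnatr_eq0 -lt0n fact_gt0.
have cF : continuous F.
  by move=> x; apply: differentiable_continuous; apply/derivable1_diffP; case: (dF x).
have cf : continuous (fun x : R => (y - x) ^+ r / r`!%:R).
  move=> x; apply: cvgM; last exact: cvg_cst.
  apply: (@continuous_comp _ _ _ (fun x => y - x) (fun x => x ^+ r)); last exact: exprn_continuous.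
  by apply: cvgB; [exact: cvg_cst|exact: cvg_id].
rewrite (@continuous_FTC2 _ _ F)//.
- by rewrite /F subrr subr0 expr0n mul0r oppr0 -EFinB sub0r opprK.
- exact: continuous_subspaceT.
- split; last 2 first.
  + exact: cvg_at_right_filter (cF _).
  + exact: cvg_at_left_filter (cF _).
  by move=> x _; case: (dF x).
- by move=> x _; rewrite derive1E; have [_ ->] := dF x.
Qed.

HB.instance Definition _ J :=
  isMeasurableFun.Build _ _ _ _ (psum X J) (measurable_psum X J).

(* Convolution with the uniform law: [psum J] is the sum of the independent
   variables [X j] and [psum (J :\ j)]. *)
Lemma psum_conv J j y : j \in J ->
  P [set t | psum X J t < y] =
  (\int[lebesgue_measure]_(x in `[0%R, 1%R])
     P [set t | (psum X (J :\ j) t < y - x)%R])%E.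
Proof.
move=> jJ; set J' := J :\ j.
pose Y : {RV P >-> R} := psum X J'.
pose U := uniform_prob (@ltr01 R).
pose S : measurableType _ := measurableTypeR R.
pose XY t : S * R := (X j t, Y t).
have mX : measurable_fun setT (X j : T -> S) by exact: (measurable_funP (X j)).
have mXY : measurable_fun setT XY by apply: measurable_fun_pair.
pose A : set (S * R) := [set u | u.1 + u.2 < y].
have mA : measurable A.
  have mD : measurable_fun setT (fun u : S * R => u.1 + u.2).
    exact: (@measurable_realfun.measurable_funD _ _ R _ (fst : S * R -> R) snd measurable_fst measurable_snd).
  have -> : A = (fun u : S * R => u.1 + u.2) @^-1` `]-oo, y[%classic.
    by apply/seteqP; split => u; rewrite /A /preimage /= in_itv.
  by rewrite -[X in measurable X]setTI; apply: mD.
(* The joint law of [X j] and [Y] factors on rectangles, so uniqueness of product measures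
   identifies it with the product law. [X j] is viewed as a sum over a singleton to make
   [psum_g_sigma] applicable. *)
have rect (B : set S) (C : set R) : measurable B -> measurable C ->
    pushforward P XY (B `*` C) = (U B * distribution P Y C)%E.
  move=> mB mC; rewrite /U -(unifX j mB) /distribution /pushforward.
  have -> : XY @^-1` (B `*` C) = X j @^-1` B `&` Y @^-1` C by [].
  have {1}-> : X j @^-1` B = psum X [set j]%SET @^-1` B.
    by apply/funext => t; rewrite /preimage /psum /= big_set1.
  have -> : X j @^-1` B = psum X [set j]%SET @^-1` B.
    by apply/funext => t; rewrite /preimage /psum /= big_set1.
  apply: (grouping_indep indX (J := [set j]%SET) (K := J')).
  - by move=> i; rewrite !inE => /andP[].
  - exact: psum_g_sigma.
  - exact: psum_g_sigma.
have -> : P [set t | psum X J t < y] = pushforward P XY A.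
  rewrite /pushforward; congr (P _); apply/funext => t.
  by rewrite /preimage /A /XY /= /psum (big_setD1 j).
pose XYm : {mfun T >-> (S * R)%type} := mfun_Sub (mem_set mXY).
rewrite -(@product_measure_unique _ _ _ _ R (uniform_prob (@ltr01 R))
  (distribution P Y) (pushforward P XYm) rect A mA).
rewrite /product_measure1 integral_uniform//; last first.
  exact: (measurable_fun_xsection (distribution P Y) mA).
rewrite subr0 invr1 mul1e; apply: eq_integral => x _ /=.
rewrite /distribution /pushforward; congr (P _); apply/funext => t.
rewrite /preimage /= /xsection /= /A; apply/propext.
by rewrite inE /= ltrBrDl.
Unshelve. exact: mXY.
Qed.

(** Induction on the number of summands through [psum_conv]. For [y <= 1] only the first term of the
    Irwin-Hall formula is present. The zero branch matters also at [y = 0] with no summands, where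
    the strict inequality fails although [0 ^ 0 / 0!] is 1. *)
Lemma psum_law J y : y <= 1 ->
  P [set t | psum X J t < y] =
  (if y <= 0 then 0 else y ^+ #|J| / (#|J|)`!%:R)%:E.
Proof.
move cJ: #|J| => r; elim: r J cJ y => [|r IH] J cJ y y1.
  move/eqP: cJ; rewrite cards_eq0 => /eqP->; rewrite /psum.
  have -> : [set t : T | \sum_(i in finset.set0) X i t < y] = [set t | 0 < y].
    by apply/funext => t /=; rewrite big_set0.
  case: (leP y 0) => [y0|y0].
    by rewrite (_ : [set _ | _] = set0) ?measure0//; apply/seteqP; split => // t /=.
  rewrite (_ : [set _ | _] = setT); last by apply/seteqP; split.
  by rewrite probability_setT expr0 fact0 divr1.
have /card_gt0P[j jJ] : (0 < #|J|)%N by rewrite cJ.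
have cJ' : #|J :\ j| = r by move: cJ; rewrite (cardsD1 j J) jJ => -[].
rewrite (psum_conv _ jJ).
(* The probability given by the induction hypothesis vanishes for [x >= y], which cuts the domain
   down to [x < y]. *)
transitivity (\int[lebesgue_measure]_(x in `[0%R, 1%R])
    (((fun x : R => ((y - x) ^+ r / r`!%:R)%:E) \_ `[0%R, y[) x))%E.
  apply: eq_integral => x; rewrite inE /= in_itv /= => /andP[x0 x1].
  rewrite (IH _ cJ'); last by rewrite lerBlDr (le_trans y1)// lerDl.
  rewrite patchE; case: ifPn => [|].
    rewrite subr_le0 => yx; rewrite ifF//; apply/negbTE/negP.
    by rewrite inE /= in_itv /= x0 ltNge yx.
  by rewrite subr_le0 -ltNge => xy; rewrite ifT// inE /= in_itv /= x0.
rewrite -integral_mkcondr.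
case: (leP y 0) => [y0|y0].
  rewrite (_ : _ `&` _ = set0) ?integral_set0//.
  apply/seteqP; split => // x /= [_]; rewrite in_itv /= => /andP[x0 xy].
  by have := le_lt_trans x0 xy; rewrite ltNge y0.
rewrite (_ : _ `&` _ = `[0%R, y[%classic); last first.
  apply/seteqP; split => x /=; rewrite !in_itv /=; first by case.
  by move=> /andP[-> xy]; rewrite xy (ltW (lt_le_trans xy y1)).
rewrite integral_itv_bndo_bndc ?integral_pow//.
apply/measurable_realfun.measurable_EFinP; apply: measurable_realfun.measurable_funM => //.
by apply: measurable_realfun.measurable_funX; apply: measurable_realfun.measurable_funB.
Qed.

(** Since [uniform01] fixes only the law, a sum may be negative at some points; [light_clique_pair]
    discards them through this null event. *)
Lemma psum_neg_null J : P [set t | psum X J t < 0] = 0%E.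
Proof. by rewrite psum_law ?lexx ?ler01. Qed.

End SumLaw.

(** * Chen-Stein for events determined by independent variables *)

Lemma fin_preimage_sum {d : measure_display} {T : measurableType d}
    {R : realType} (P : probability T R) {F : finType} (f : T -> F) (Q : pred F) :
  (forall a, measurable (f @^-1` [set a])) ->
  \sum_(a | Q a) fine (P (f @^-1` [set a])) = fine (P [set t | Q (f t)]).
Proof.
move=> mf; apply: EFin_inj; rewrite -sumEFin.
have -> : [set t | Q (f t)] = \bigcup_(a in [set` Q]) f @^-1` [set a].
  apply/seteqP; split => [t Qt|t [a Qa]]; first by exists (f t).
  by rewrite /preimage /= => ->.
rewrite measure_fin_bigcup//; last first.
  by move=> a b _ _ [t []]; rewrite /preimage /= => -> ->.
rewrite -(@bigfs _ _ _ _ (index_enum F)) ?index_enum_uniq//; last by move=> a _; rewrite mem_index_enum.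
rewrite (eq_bigr (fun a => P (f @^-1` [set a]))); last first.
  by move=> a _; rewrite fineK// fin_num_measure.
by rewrite fineK// sum_fin_num; apply/allP => _ /mapP[a _ ->]; rewrite /= fin_num_measure.
Qed.

Section EventChenStein.
Context {d : measure_display} {T : measurableType d} {R : realType}.
Context {P : probability T R} {I F : finType}.
Variables (X : I -> {RV P >-> R}) (ev : F -> set T).
Variables (supp : F -> {set I}) (N : F -> {set F}).
Hypothesis indX : mutually_independent X.
Hypothesis ev_sigma : forall a, <<s cylinder X (supp a) >> (ev a).
Hypothesis N_refl : forall a, a \in N a.
Hypothesis supp_disj : forall a b, b \notin N a ->
  {in supp b, forall i, i \notin supp a}.

Definition occurring (t : T) : {set F} := [set a | t \in ev a]%SET.

Lemma in_occurring a t : (a \in occurring t) = (t \in ev a).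
Proof. by rewrite inE. Qed.

Lemma cylinder_sub (J K : {set I}) : J \subset K -> cylinder X J `<=` cylinder X K.
Proof.
move=> /fintype.subsetP JK _ [B mB ->].
exists (fun i => if i \in J then B i else setT).
  by move=> i _; case: (boolP (i \in J)) => // /mB.
apply/seteqP; split => t tB i /= iJ.
  by case: ifPn => [|//]; exact: tB.
by have := tB i (JK i iJ); rewrite /= iJ.
Qed.

Lemma g_cylinder_sub (J K : {set I}) : J \subset K ->
  <<s cylinder X J >> `<=` <<s cylinder X K >>.
Proof. by move=> JK; apply: sub_smallest2r; [exact: smallest_sigma_algebra|exact: cylinder_sub]. Qed.

(** A prescribed pattern of occurrences is a finite intersection of events and complements. This
    places what happens outside a neighbourhood in the sigma-algebra of the variables off
    [supp a]. *)
Lemma occurring_sigma (S : pred F) (K : {set I}) (B : {set F}) :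
  (forall a, S a -> supp a \subset K) ->
  <<s cylinder X K >> [set t | [forall (a | S a), (a \in occurring t) == (a \in B)]].
Proof.
move=> SK; pose M : measurableType _ := g_sigma_algebraType (cylinder X K).
have evM a : S a -> measurable (ev a : set M).
  by move=> Sa; apply: (g_cylinder_sub (SK a Sa)); exact: ev_sigma.
have -> : [set t | [forall (a | S a), (a \in occurring t) == (a \in B)]] =
    \bigcap_(a in [set` S]) (if a \in B then ev a else ~` ev a).
  apply/seteqP; split => t /=.
    move=> /forallP tB a Sa /=; have /implyP/(_ Sa)/eqP := tB a.
    by rewrite in_occurring; case: ifPn => _; [move/set_mem|move/negbT; rewrite notin_setE].
  move=> tB; apply/forallP => a; apply/implyP => Sa; have := tB a Sa.
  rewrite in_occurring; case: ifPn => _ h; apply/eqP; first exact/mem_set.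
  by apply/negbTE; rewrite notin_setE.
apply: (@fin_bigcap_measurable _ M); first exact: finite_finset.
by move=> a Sa; case: ifPn => _; [|apply: measurableC]; exact: evM.
Qed.

Lemma measurable_ev a : measurable (ev a).
Proof. by apply: (g_cylinder_measurable (X := X) (J := supp a)). Qed.

Lemma measurable_occurring (B : {set F}) : measurable (occurring @^-1` [set B]).
Proof.
have := @occurring_sigma xpredT [set: I]%SET B (fun a _ => finset.subsetT _).
move=> /(g_cylinder_measurable (X := X) (J := [set: I]%SET)); congr (measurable _).
apply/seteqP; split => t /=.
  by move=> /forallP h; apply/setP => a; apply/eqP; exact: h.
by move=> <-; apply/forallP => a /=; rewrite eqxx.
Qed.

Let p a := fine (P (ev a)).

(** This is [chen_stein] for the law of [occurring]. Its independence hypothesis follows from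
    [grouping_indep], as the events outside [N a] use no variable of [supp a]. *)
Lemma event_chen_stein :
  `|fine (P [set t | occurring t == finset.set0]) - expR (- \sum_a p a)| <=
  \sum_a \sum_(b in N a) p a * p b +
  \sum_a \sum_(b in N a :\ a) fine (P (ev a `&` ev b)).
Proof.
pose q (A : {set F}) := fine (P (occurring @^-1` [set A])).
have qE (Q : pred {set F}) : \sum_(A | Q A) q A = fine (P [set t | Q (occurring t)]).
  exact: fin_preimage_sum measurable_occurring.
have pE a : p a = \sum_(A : {set F} | a \in A) q A.
  rewrite qE /p; congr (fine (P _)); apply/seteqP; split => t /=.
    by rewrite in_occurring inE.
  by rewrite in_occurring inE.
have pfE : p = fun a => \sum_(A : {set F} | a \in A) q A by apply/funext.
have -> : \sum_a \sum_(b in N a :\ a) fine (P (ev a `&` ev b)) =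
    \sum_a \sum_(b in N a :\ a) \sum_(A : {set F} | (a \in A) && (b \in A)) q A.
  apply: eq_bigr => a _; apply: eq_bigr => b _.
  rewrite qE; congr (fine (P _)); apply/seteqP; split => t /=.
    by case=> /mem_set ta /mem_set tb; rewrite !in_occurring ta.
  by rewrite !in_occurring => /andP[/set_mem ta /set_mem tb].
rewrite (_ : fine (P [set t | occurring t == finset.set0]) = q finset.set0); last first.
  rewrite /q; congr (fine (P _)); apply/seteqP; split => t /=; first by move=> /eqP.
  by rewrite /preimage /= => ->.
rewrite pfE; apply: chen_stein => //.
- by move=> A; rewrite fine_ge0.
- by rewrite qE -[RHS]/(fine 1%E) -(probability_setT P); congr (fine (P _)); apply/seteqP; split.
move=> a B; rewrite -pE !qE.
pose G := [set t | occurring t :\: N a == B].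
have -> : [set t | (a \in occurring t) && (occurring t :\: N a == B)] = ev a `&` G.
  apply/seteqP; split => t /=; rewrite in_occurring.
    by move=> /andP[/set_mem].
  by case=> /mem_set -> ->.
suff -> : P (ev a `&` G) = (P (ev a) * P G)%E.
  have mG : measurable G.
    have -> : G = \bigcup_(A in [set A : {set F} | A :\: N a == B]) occurring @^-1` [set A].
      apply/seteqP; split => [t Gt|t [A AG]]; first by exists (occurring t).
      by rewrite /preimage /G /= => ->.
    apply: fin_bigcup_measurable; first exact: finite_finset.
    by move=> A _; exact: measurable_occurring.
  by rewrite fineM// fin_num_measure//; exact: measurable_ev.
(* A value [B] that meets [N a] is impossible, and then both sides vanish. *)
have [BN|BN] := boolP (B \subset ~: N a); last first.
  rewrite (_ : G = set0) ?setI0 ?measure0 ?mule0//.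
  apply/seteqP; split => // t /= /eqP BE; move/negP: BN; apply.
  by rewrite -BE; apply/fintype.subsetP => b; rewrite !inE => /andP[].
apply: (grouping_indep indX (J := supp a) (K := ~: supp a)).
- by move=> i; rewrite inE.
- exact: ev_sigma.
have -> : G = [set t | [forall (b | b \notin N a), (b \in occurring t) == (b \in B)]].
  apply/seteqP; split => t /=.
    by move=> /eqP <-; apply/forallP => b; apply/implyP => bN; rewrite finset.in_setD bN.
  move=> /forallP tB; apply/eqP/setP => b; rewrite finset.in_setD.
  case: (boolP (b \in N a)) => [bN|bN] /=.
    apply/esym/negbTE; apply: contraL bN => bB.
    by have := fintype.subsetP BN b bB; rewrite inE.
  by have /implyP/(_ bN)/eqP := tB b.
apply: occurring_sigma => b bN; apply/fintype.subsetP => i ib.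
by rewrite inE; exact: supp_disj bN i ib.
Qed.

End EventChenStein.

(** * Cliques and their overlaps *)

Section Cliques.
Context {n : nat}.
Implicit Types S U : {set 'I_n}.

Definition clique_edges S : {set edge n} := [set e : edge n | val e \subset S]%SET.

Lemma card_clique_edges S : #|clique_edges S| = 'C(#|S|, 2).
Proof.
rewrite -cards_draws -(card_imset _ val_inj); apply: eq_card => A.
rewrite !inE; apply/imsetP/andP => [[e eS ->]|[AS A2]].
  by move: eS; rewrite inE; split => //; exact: (valP e).
by exists (exist _ A A2); rewrite ?inE.
Qed.

Lemma clique_edgesI S U :
  clique_edges S :&: clique_edges U = clique_edges (S :&: U).
Proof. by apply/setP => e; rewrite !inE finset.subsetI. Qed.

Lemma card_clique_edgesD S U :
  #|clique_edges U :\: clique_edges S| = ('C(#|U|, 2) - 'C(#|S :&: U|, 2))%N.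
Proof. by rewrite cardsD clique_edgesI finset.setIC !card_clique_edges. Qed.

Lemma clique_edges_disj S U : (#|S :&: U| <= 1)%N ->
  {in clique_edges U, forall e, e \notin clique_edges S}.
Proof.
move=> SU e eU; apply/negP => eS.
have := card_clique_edges (S :&: U); rewrite -clique_edgesI bin_small//.
by move/eqP; rewrite cards_eq0 => /eqP/setP/(_ e); rewrite finset.in_setI eU eS inE.
Qed.

(** [U] is determined by its part inside [S], of size [l], and its part outside, of size [k - l]. *)
Lemma card_overlap_le S (k l : nat) : #|S| = k ->
  (#|[set U : {set 'I_n} | (#|U| == k) && (#|S :&: U| == l)]%SET| <=
     'C(k, l) * 'C(n - k, k - l))%N.
Proof.
move=> Sk.
have -> : ('C(k, l) * 'C(n - k, k - l))%N =
    #|finset.setX [set A : {set 'I_n} | (A \subset S) && (#|A| == l)]%SET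
           [set A : {set 'I_n} | (A \subset ~: S) && (#|A| == k - l)%N]%SET|.
  by rewrite cardsX !cards_draws Sk cardsCs finset.setCK card_ord Sk.
have inj : injective (fun U : {set 'I_n} => (S :&: U, U :\: S)).
  by move=> U V [SU SV]; rewrite -(finset.setID U S) finset.setIC SU SV finset.setIC finset.setID.
rewrite -(card_imset _ inj); apply/subset_leq_card/fintype.subsetP => _ /imsetP[U + ->].
rewrite !inE => /andP[/eqP Uk /eqP SUl] /=.
rewrite finset.subsetIl SUl eqxx /= cardsD Uk finset.setIC SUl eqxx andbT.
by apply/fintype.subsetP => v; rewrite !inE => /andP[].
Qed.

End Cliques.

(** * Binomial and factorial estimates *)

Lemma bin2D (l i : nat) : 'C(l + i, 2) = ('C(l, 2) + l * i + 'C(i, 2))%N.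
Proof.
elim: i => [|i IH]; first by rewrite addn0 muln0 bin0n /= !addn0.
by rewrite addnS !binS !bin1 IH mulnS; lia.
Qed.

Lemma double_bin2 (i : nat) : ('C(i, 2) * 2 + i = i * i)%N.
Proof. by elim: i => // i IH; rewrite binS bin1; nia. Qed.

(** The gain of one over [factM_le] matters in [fact_overlap] at [l = k - 2], where exactly [2k - 3]
    edges remain. *)
Lemma factS_mul_le (a j : nat) : (0 < a)%N -> (a`! * (j.+1)`! <= (a + j)`!)%N.
Proof.
move=> a0; elim: j => [|j IH]; first by rewrite addn0 !factS fact0 !muln1.
rewrite addnS (factS (a + j)) (factS j.+1) mulnCA leq_mul//.
by rewrite ltnS -add1n leq_add2r.
Qed.

Lemma ffact_le_expn (n k : nat) : (n ^_ k <= n ^ k)%N.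
Proof.
elim: k => // k IH; rewrite ffactnSr expnSr leq_mul//; exact: leq_subr.
Qed.

(** Equality holds for [l = k - 1]. For smaller [l] the last factorial suffices: its argument counts
    the edges outside the common part, at least [2k - 3], and [factS_mul_le] bounds the square of
    [(k - 1)!] by [(2k - 3)!]. *)
Lemma fact_overlap (k l : nat) : (2 <= l)%N -> (l < k)%N ->
  (k.-1`! ^ 2 <= l`! * (k - l)`! ^ 2 * ('C(k, 2) - 'C(l, 2))`!)%N.
Proof.
move=> l2 lk; have [i ->] : exists i, k = (l + i.+1)%N by exists (k - l).-1; lia.
rewrite bin2D addKn -addnA addKn.
case: i => [|i]; first by rewrite addn1 /= muln1 addn0 !factS fact0 !muln1 mulnn.
rewrite (@leq_trans ((l * i.+2 + 'C(i.+2, 2))`!))//; last first.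
  by rewrite leq_pmull// muln_gt0 expn_gt0 !fact_gt0.
rewrite addnS /=; have := @factS_mul_le (l + i.+1) (l + i) _.
rewrite -addnS mulnn => h; apply: leq_trans (h _) _; first by lia.
apply: leq_fact; have := double_bin2 i.+2; nia.
Qed.

(** Clearing denominators leaves the falling factorials [n ^_ k] and [(n - k) ^_ (k - l)], with
    [2k - l] factors in all, each at most [n]. *)
Lemma pair_count_le (n k l : nat) : (l <= k)%N -> (k <= n)%N ->
  ('C(n, k) * ('C(k, l) * 'C(n - k, k - l)) * (l`! * (k - l)`! ^ 2) <= n ^ (2 * k - l))%N.
Proof.
move=> lk kn.
have -> : ('C(n, k) * ('C(k, l) * 'C(n - k, k - l)) * (l`! * (k - l)`! ^ 2) =
    n ^_ k * (n - k) ^_ (k - l))%N.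
  by rewrite -(bin_ffact n k) -(bin_ffact (n - k)) -(bin_fact lk); ring.
rewrite (_ : 2 * k - l = k + (k - l))%N; last by lia.
rewrite expnD leq_mul ?ffact_le_expn//.
apply: leq_trans (ffact_le_expn _ _) _.
by case: (k - l)%N => // e; rewrite leq_exp2r ?leq_subr.
Qed.

(** * Contributions of overlapping pairs *)

Section OverlapBounds.
Context {R : realType}.
Variables (n k : nat) (w : R).
Hypotheses (hk : (3 <= k)%N) (kn : (k <= n)%N).
Hypotheses (w0 : 0 <= w) (w1 : w <= 1) (nw : n%:R ^+ 2 * w ^+ k <= 1).

Let m := 'C(k, 2).
Let p : R := w ^+ m / m`!%:R.

(* The bound on the contribution of the pairs of cliques with [k - 1] common
   vertices, which dominates that of every smaller overlap. *)
Definition overlap_bound : R :=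
  n%:R ^+ k.+1 * w ^+ (m + k.-1) / (m`!%:R * (k.-1)`!%:R ^+ 2).

Lemma overlap_bound_ge0 : 0 <= overlap_bound.
Proof. by rewrite divr_ge0 ?mulr_ge0 ?exprn_ge0. Qed.

(** With [k = l + j + 1] the left side is the right side times [n ^ j * w ^ e]. The square of this
    factor is at most [(n ^ 2 * w ^ k) ^ j <= 1], because [2e - kj = j(l - 2) >= 0]; squaring avoids
    half-integer exponents. *)
Lemma overlap_pow_le (l : nat) : (2 <= l)%N -> (l < k)%N ->
  n%:R ^+ (2 * k - l) * w ^+ (m - 'C(l, 2)) <= n%:R ^+ k.+1 * w ^+ k.-1.
Proof.
rewrite /m => l2 lk.
have [j kE] : exists j, k = (l + j.+1)%N by exists (k - l).-1; lia.
have jj := double_bin2 j.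
pose e := (l * j + 'C(j, 2))%N.
have -> : ('C(k, 2) - 'C(l, 2) = k.-1 + e)%N.
  by rewrite kE bin2D binS bin1 /e mulnS; lia.
have -> : (2 * k - l = k.+1 + j)%N by lia.
rewrite (exprD _ k.+1 j) (exprD _ k.-1 e) mulrACA ler_piMr ?mulr_ge0 ?exprn_ge0//.
rewrite -(@expr_le1 _ 2) ?mulr_ge0 ?exprn_ge0//.
apply: (@le_trans _ _ ((n%:R ^+ 2 * w ^+ k) ^+ j)); last first.
  by rewrite exprn_ile1 ?mulr_ge0 ?exprn_ge0.
rewrite [leRHS]exprMn [leLHS]exprMn -!exprM (mulnC j 2) ler_wpM2l ?exprn_ge0//.
by apply: ler_wiXn2l => //; rewrite /e; nia.
Qed.

Lemma overlap_term_le (l : nat) : (2 <= l)%N -> (l < k)%N ->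
  ('C(n, k) * ('C(k, l) * 'C(n - k, k - l)))%:R *
    (p * (w ^+ (m - 'C(l, 2)) / (m - 'C(l, 2))`!%:R)) <= overlap_bound.
Proof.
move=> l2 lk; set s := (m - 'C(l, 2))%N; set c := ('C(n, k) * _)%N.
have cs : (c * k.-1`! ^ 2 <= n ^ (2 * k - l) * s`!)%N.
  apply: leq_trans (leq_mul (leqnn c) (fact_overlap l2 lk)) _.
  by rewrite mulnA leq_mul//; exact: pair_count_le (ltnW lk) kn.
have mf : 0 < m`!%:R :> R by rewrite ltr0n fact_gt0.
have sf : 0 < s`!%:R :> R by rewrite ltr0n fact_gt0.
have kf : 0 < (k.-1)`!%:R ^+ 2 :> R by rewrite exprn_gt0// ltr0n fact_gt0.
have h : c%:R * w ^+ s / s`!%:R <= n%:R ^+ k.+1 * w ^+ k.-1 / (k.-1)`!%:R ^+ 2.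
  rewrite ler_pdivrMr// mulrAC ler_pdivlMr//.
  apply: (@le_trans _ _ (n%:R ^+ (2 * k - l) * w ^+ s * s`!%:R)); last first.
    by rewrite ler_wpM2r ?overlap_pow_le// ltW.
  rewrite mulrAC [leRHS]mulrAC ler_wpM2r ?exprn_ge0//.
  by rewrite -!natrX -!natrM ler_nat.
have -> : c%:R * (p * (w ^+ s / s`!%:R)) = c%:R * w ^+ s / s`!%:R * (w ^+ m / m`!%:R).
  by rewrite /p; ring.
have -> : overlap_bound =
    n%:R ^+ k.+1 * w ^+ k.-1 / (k.-1)`!%:R ^+ 2 * (w ^+ m / m`!%:R).
  by rewrite /overlap_bound exprD; field; rewrite (gt_eqF mf) pnatr_eq0 -lt0n fact_gt0.
by rewrite ler_wpM2r// divr_ge0 ?exprn_ge0.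
Qed.

Lemma bin2_ge : (k <= m)%N.
Proof. by have := double_bin2 k; rewrite -/m; nia. Qed.

(** Two common vertices give at least one common edge, so [s < m]: the power gains a factor [w], and
    [m!] is at least [m >= 3] times [s!]. *)
Lemma self_term_le (l : nat) : (2 <= l)%N -> (l < k)%N ->
  p <= w / 3%:R * (w ^+ (m - 'C(l, 2)) / (m - 'C(l, 2))`!%:R).
Proof.
move=> l2 lk; set s := (m - 'C(l, 2))%N.
have km := bin2_ge.
have l1 : (0 < 'C(l, 2))%N by rewrite bin_gt0.
have sm : (s < m)%N by rewrite /s; lia.
rewrite /p mulrACA -invfM -exprS ler_pM ?exprn_ge0 ?invr_ge0//.
  exact: ler_wiXn2l.
rewrite lef_pV2 ?posrE ?mulr_gt0 ?ltr0n ?fact_gt0// -natrM ler_nat.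
rewrite -(prednK (leq_ltn_trans (leq0n s) sm)) factS leq_mul//.
  by rewrite prednK; lia.
by apply: leq_fact; lia.
Qed.

(** This handles the pairs of a clique with itself. The 27 is a lower bound for [n * k ^ 2]; the
    rest uses [k! <= m!] and [m + k <= 2m]. *)
Lemma diag_term_le : 'C(n, k)%:R * (p * p) <= w / 27%:R * overlap_bound.
Proof.
have km := bin2_ge.
have mf : 0 < m`!%:R :> R by rewrite ltr0n fact_gt0.
have kf : 0 < (k.-1)`!%:R ^+ 2 :> R by rewrite exprn_gt0// ltr0n fact_gt0.
have h : ('C(n, k) * (27 * k.-1`! ^ 2) <= n ^ k.+1 * m`!)%N.
  have h1 : (27 <= n * (k * k))%N.
    by rewrite (@leq_trans (3 * (3 * 3)))// leq_mul ?leq_mul// (leq_trans hk).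
  have h2 : ('C(n, k) * k`! <= n ^ k)%N by rewrite bin_ffact ffact_le_expn.
  have h3 : (k`! = k * k.-1`!)%N by rewrite -{1}(prednK (ltnW (ltnW hk))) factS prednK// ltnW// ltnW.
  have h4 : (k`! <= m`!)%N by exact: leq_fact.
  apply: (@leq_trans ('C(n, k) * (n * (k * k) * k.-1`! ^ 2))).
    by rewrite leq_mul// leq_mul.
  have -> : ('C(n, k) * (n * (k * k) * k.-1`! ^ 2) = n * ('C(n, k) * k`!) * k`!)%N.
    by rewrite h3; ring.
  by rewrite expnS leq_mul// leq_mul.
have -> : 'C(n, k)%:R * (p * p) = 'C(n, k)%:R * w ^+ (m + m) / m`!%:R / m`!%:R.
  by rewrite /p exprD; field; rewrite gt_eqF.
have -> : w / 27%:R * overlap_bound =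
  n%:R ^+ k.+1 * w ^+ (m + k) / (27%:R * (k.-1)`!%:R ^+ 2) / m`!%:R.
  have -> : w ^+ (m + k) = w * w ^+ (m + k.-1).
    by rewrite -exprS -addnS prednK// ltnW// ltnW.
  by rewrite /overlap_bound; field; rewrite (gt_eqF mf) pnatr_eq0 -lt0n fact_gt0.
rewrite ler_pM2r ?invr_gt0// ler_pdivrMr// mulrAC ler_pdivlMr ?mulr_gt0//.
rewrite mulrAC [leRHS]mulrAC ler_pM ?mulr_ge0 ?exprn_ge0//.
  by rewrite -!natrX -!natrM ler_nat.
by apply: ler_wiXn2l => //; rewrite leq_add2l.
Qed.

Lemma total_overlap_le : w <= 27%:R / 70%:R ->
  'C(n, k)%:R * (p * p) +
  \sum_(2 <= l < k) ('C(n, k) * ('C(k, l) * 'C(n - k, k - l)))%:R *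
    (p * p + p * (w ^+ (m - 'C(l, 2)) / (m - 'C(l, 2))`!%:R)) <=
  8%:R / 7%:R * (k%:R - 2%:R) * overlap_bound.
Proof.
move=> wb; have Q0 := overlap_bound_ge0; set Q := overlap_bound in Q0 *.
have p0 : 0 <= p by rewrite divr_ge0 ?exprn_ge0.
have k21 : 1 <= k%:R - 2%:R :> R.
  by rewrite -natrB 1?ltnW// ler1n subn_gt0.
apply: (@le_trans _ _ (w / 27%:R * Q + \sum_(2 <= l < k) (1 + w / 3%:R) * Q)).
  apply: lerD; first exact: diag_term_le.
  rewrite big_seq [leRHS]big_seq; apply: ler_sum => l; rewrite mem_index_iota => /andP[l2 lk].
  set g := w ^+ _ / _; set c := ('C(n, k) * _)%N.
  apply: (@le_trans _ _ ((1 + w / 3%:R) * (c%:R * (p * g)))).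
    rewrite [leRHS]mulrCA ler_wpM2l//.
    have := ler_wpM2l p0 (self_term_le l2 lk); rewrite -/g; lra.
  rewrite ler_wpM2l//; last exact: overlap_term_le.
  by rewrite addr_ge0// divr_ge0.
rewrite sumr_const_nat -(mulr_natr _ (k - 2)) natrB 1?ltnW//.
(* As [k - 2 >= 1], the two corrections add up to at most [10 w / 27] times [k - 2], and [10/27]
   times [27/70] is [1/7]. *)
have : (w / 27%:R + (1 + w / 3%:R) * (k%:R - 2%:R)) * Q <= 8%:R / 7%:R * (k%:R - 2%:R) * Q.
  rewrite ler_wpM2r//.
  have : w * 1 <= w * (k%:R - 2%:R) by rewrite ler_wpM2l.
  have : w * (k%:R - 2%:R) <= 27%:R / 70%:R * (k%:R - 2%:R) by rewrite ler_wpM2r//; lra.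
  lra.
lra.
Qed.

End OverlapBounds.

(** * Poisson approximation for light cliques *)

Section CliquePoisson.
Context {d : measure_display} {T : measurableType d} {R : realType}.
Context {P : probability T R} {n : nat}.
Variables (X : edge n -> {RV P >-> R}) (k : nat) (w : R).
Hypothesis indX : mutually_independent X.
Hypothesis unifX : forall e, uniform01 (X e).
Hypotheses (hk : (3 <= k)%N) (kn : (k <= n)%N).
Hypotheses (w0 : 0 <= w) (w1 : w <= 1) (nw : n%:R ^+ 2 * w ^+ k <= 1).
Hypothesis wb : w <= 27%:R / 70%:R.
Implicit Types S U : {set 'I_n}.

Let m := 'C(k, 2).
Let p : R := w ^+ m / m`!%:R.
Let g (l : nat) : R := w ^+ (m - 'C(l, 2)) / (m - 'C(l, 2))`!%:R.

(** All vertex sets serve as indices; those of the wrong size carry the empty event and contribute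
    nothing. *)
Definition light_clique S : set T :=
  if #|S| == k then [set t | psum X (clique_edges S) t < w] else set0.

(* [S] is adjoined because it may have fewer than two vertices. *)
Definition overlapping S : {set {set 'I_n}} :=
  S |: [set U : {set 'I_n} | (1 < #|S :&: U|)%N]%SET.

Lemma measurable_psum_lt (J : {set edge n}) y : measurable [set t | psum X J t < y].
Proof.
have := @measurable_psum _ _ _ _ _ X J measurableT `]-oo, y[%classic (measurable_itv _).
by rewrite setTI; congr measurable; apply/seteqP; split => t /=; rewrite in_itv.
Qed.

Lemma psum_lt_le (J : {set edge n}) :
  fine (P [set t | psum X J t < w]) <= w ^+ #|J| / (#|J|)`!%:R.
Proof.
rewrite (psum_law indX unifX)//=; case: ifP => _ //.
by rewrite divr_ge0 ?exprn_ge0.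
Qed.

Lemma light_clique_prob S : fine (P (light_clique S)) = if #|S| == k then p else 0.
Proof.
rewrite /light_clique; case: eqP => [Sk|_]; last by rewrite measure0.
rewrite (psum_law indX unifX)//= card_clique_edges Sk -/m.
(* The zero branch of the law agrees with [p], since [w = 0] and [m] is positive. *)
rewrite /p; case: ifP => // w_le0; have -> : w = 0 by apply/eqP; rewrite eq_le w_le0.
by rewrite expr0n gtn_eqF ?mul0r// bin_gt0 ltnW.
Qed.

Lemma light_clique_sigma S :
  <<s cylinder X (clique_edges S) >> (light_clique S).
Proof.
rewrite /light_clique; case: ifP => _.
  have := @psum_g_sigma _ _ _ _ _ X (clique_edges S) `]-oo, w[%classic (measurable_itv _).
  by congr (<<s _ >> _); apply/seteqP; split => t /=; rewrite /preimage /= in_itv.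
have [h _ _] := smallest_sigma_algebra [set: T] (cylinder X (clique_edges S)).
exact: h.
Qed.

Lemma measurable_light_clique S : measurable (light_clique S).
Proof.
apply: (g_cylinder_measurable (X := X) (J := clique_edges S)).
exact: light_clique_sigma.
Qed.

(* Off the null event that the common edges have negative total weight, both
   cliques being light forces the edges of [U] outside [S] to be light. *)
Lemma light_clique_pair S U : #|S| = k -> #|U| = k ->
  fine (P (light_clique S `&` light_clique U)) <= p * g #|S :&: U|.
Proof.
move=> Sk Uk; set K := clique_edges U :\: clique_edges S.
set L := clique_edges U :&: clique_edges S.
have mS := measurable_light_clique S.
have mU := measurable_light_clique U.
have mK := @measurable_psum_lt K w; have mL := @measurable_psum_lt L 0.
have sub : light_clique S `&` light_clique U `<=`
    (light_clique S `&` [set t | psum X K t < w]) `|` [set t | psum X L t < 0].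
  move=> t [St Ut]; have [L0|L0] := ltP (psum X L t) 0; [by right|left; split=> //].
  move: Ut; rewrite /light_clique Uk eqxx /= => Ut; apply: le_lt_trans Ut.
  by rewrite [leRHS]/psum (big_setID (clique_edges S)) /= lerDr.
have le1 : (P (light_clique S `&` light_clique U) <=
    P (light_clique S `&` [set t | (psum X K t < w)%R]))%E.
  rewrite -[leRHS]adde0 -(psum_neg_null indX unifX L).
  apply: (le_trans _ (measureU2 _ _ _)) => //; last exact: measurableI.
  by apply: le_measure sub; rewrite inE; [exact: measurableI|apply: measurableU => //; exact: measurableI].
apply: (@le_trans _ _ (fine (P (light_clique S `&` [set t | psum X K t < w])))).
  by rewrite fine_le// fin_num_measure//; exact: measurableI.
rewrite (grouping_indep indX (J := clique_edges S) (K := K)).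
- rewrite fineM ?fin_num_measure// light_clique_prob Sk eqxx.
  rewrite ler_wpM2l ?divr_ge0 ?exprn_ge0//.
  by apply: le_trans (psum_lt_le _) _; rewrite card_clique_edgesD Uk.
- by move=> e; rewrite inE => /andP[].
- exact: light_clique_sigma.
have := @psum_g_sigma _ _ _ _ _ X K `]-oo, w[%classic (measurable_itv _).
by congr (<<s _ >> _); apply/seteqP; split => t /=; rewrite /preimage /= in_itv.
Qed.

Let h l := p * p + p * g l.

Lemma clique_prob_ge0 : 0 <= p. Proof. by rewrite divr_ge0 ?exprn_ge0. Qed.

Lemma pair_term_ge0 l : 0 <= h l.
Proof. by rewrite addr_ge0 ?mulr_ge0 ?clique_prob_ge0 ?divr_ge0 ?exprn_ge0. Qed.

(** Neighbours are sorted by the size [l] of the overlap. A set of size [k] other than [S] has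
    [l < k], and sets of another size contribute 0. *)
Lemma overlap_sum_le S : #|S| = k ->
  \sum_(U in overlapping S :\ S)
    (fine (P (light_clique S)) * fine (P (light_clique U)) +
     fine (P (light_clique S `&` light_clique U))) <=
  \sum_(2 <= l < k) ('C(k, l) * 'C(n - k, k - l))%:R * h l.
Proof.
move=> Sk.
apply: (@le_trans _ _ (\sum_(2 <= l < k)
    \sum_(U : {set 'I_n} | (#|U| == k) && (#|S :&: U| == l)) h l)); last first.
  apply: ler_sum => l _; rewrite sumr_const -(mulr_natl (h l)) ler_wpM2r ?pair_term_ge0// ler_nat.
  by apply: leq_trans (card_overlap_le l Sk); rewrite cardsE.
under [leRHS]eq_bigr do rewrite big_mkcond.
rewrite exchange_big big_mkcond; apply: ler_sum => U _.
have rhs0 : 0 <= \sum_(2 <= l < k)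
    (if (#|U| == k) && (#|S :&: U| == l) then h l else 0).
  by apply: sumr_ge0 => l _; case: ifP => // _; exact: pair_term_ge0.
case: ifPn => // ; rewrite !inE => /andP[US /orP[/eqP UE|SU2]].
  by rewrite UE eqxx in US.
have [Uk|Uk] := eqVneq #|U| k; last first.
  rewrite /light_clique (negPf Uk) setI0 measure0 mulr0 add0r.
  by rewrite (negPf Uk) in rhs0.
have SUk : (#|S :&: U| < k)%N.
  rewrite ltn_neqAle -{2}Sk subset_leq_card ?finset.subsetIl// andbT.
  apply: contra US => /eqP SUk.
  have /eqP SI : S :&: U == S by rewrite finset.eqEcard finset.subsetIl SUk Sk leqnn.
  have SU : S \subset U by rewrite -SI finset.subsetIr.
  by rewrite eq_sym finset.eqEcard SU Uk Sk leqnn.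
rewrite (bigD1_seq #|S :&: U|) ?mem_index_iota ?SU2 ?SUk ?iota_uniq//= eqxx.
apply: (@le_trans _ _ (h #|S :&: U|)).
  rewrite lerD ?light_clique_pair// !light_clique_prob Sk Uk eqxx//.
by rewrite lerDl; apply: sumr_ge0 => l _; case: ifP => // _; exact: pair_term_ge0.
Qed.

Lemma min_clique_weight_geE :
  [set t | (w%:E <= min_clique_weight k (fun e => X e t))%E] =
  [set t | occurring light_clique t == finset.set0].
Proof.
apply/seteqP; split => t /=.
  move=> /bigmin_geP[_ h1]; apply/eqP/setP => S; rewrite in_occurring finset.in_set0.
  apply/negbTE; rewrite notin_setE /light_clique; case: ifP => /= [Sk|_]; last by case.
  have := h1 S Sk; rewrite lee_fin leNgt => /negP h2 St; apply: h2.
  by move: St; rewrite /clique_weight /psum; congr (_ < _); apply: eq_bigl => e; rewrite inE.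
move=> /eqP occ0; apply/bigmin_geP; split; first by rewrite leey.
move=> S Sk; rewrite lee_fin leNgt; apply/negP => St.
have : S \in occurring light_clique t.
  rewrite in_occurring; apply/mem_set; rewrite /light_clique Sk /=.
  by move: St; rewrite /clique_weight /psum; congr (_ < _); apply: eq_bigl => e; rewrite inE.
by rewrite occ0 inE.
Qed.

Lemma measurable_min_clique_weight_ge :
  measurable [set t | (w%:E <= min_clique_weight k (fun e => X e t))%E].
Proof.
rewrite min_clique_weight_geE.
rewrite (_ : [set _ | _] = occurring light_clique @^-1` [set finset.set0]).
  exact: (measurable_occurring light_clique_sigma).
by apply/seteqP; split => t /= /eqP.
Qed.

Lemma clique_poisson :
  `|fine (P [set t | w%:E <= min_clique_weight k (fun e => X e t)]%E) -
    expR (- ('C(n, k)%:R * p))| <=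
  8%:R / 7%:R * (k%:R - 2%:R) * overlap_bound n k w.
Proof.
rewrite min_clique_weight_geE.
have sum_k (c : R) : \sum_(S : {set 'I_n} | #|S| == k) c = 'C(n, k)%:R * c.
  rewrite sumr_const -(mulr_natl c); congr (_%:R * _).
  by rewrite -[n in RHS]card_ord -card_draws cardsE.
have -> : 'C(n, k)%:R * p = \sum_S fine (P (light_clique S)).
  rewrite -sum_k big_mkcond; apply: eq_bigr => S _.
  by rewrite light_clique_prob.
apply: le_trans (event_chen_stein (supp := clique_edges) (N := overlapping) indX _ _ _) _.
- exact: light_clique_sigma.
- by move=> S; rewrite !inE eqxx.
- move=> S U; rewrite !inE negb_or -leqNgt => /andP[_]; exact: clique_edges_disj.
rewrite -big_split /=.
apply: le_trans (total_overlap_le hk kn w0 w1 nw wb).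
apply: (@le_trans _ _ (\sum_(S : {set 'I_n} | #|S| == k)
   (p * p + \sum_(2 <= l < k) ('C(k, l) * 'C(n - k, k - l))%:R * h l))).
  rewrite [leRHS]big_mkcond; apply: ler_sum => S _.
  have SS : S \in overlapping S by rewrite !inE eqxx.
  (* The pair of [S] with itself occurs in the first sum only, whence the lone [p * p]. *)
  rewrite (big_setD1 S SS) /= -addrA -big_split /=.
  case: eqP => [Sk|/eqP Sk].
    by rewrite lerD ?overlap_sum_le// light_clique_prob Sk eqxx.
  rewrite light_clique_prob (negPf Sk) mul0r add0r big1// => U _.
  by rewrite mul0r /light_clique (negPf Sk) set0I measure0 add0r.
rewrite sum_k mulrDr lerD2l mulr_sumr; apply: ler_sum => l _.
by rewrite mulrA -natrM.
Qed.

End CliquePoisson.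

(** * Estimates for the threshold *)

(** Equivalently, [e >= 70/27]. Four squarings of [1 + 1/16 <= expR (1/16)], rounded down to
    thousandths, give [e >= 2.614]. *)
Lemma expR_N1_le {R : realType} : expR (- 1 : R) <= 27%:R / 70%:R.
Proof.
have sq (x b c : R) : 0 <= b -> c <= b * b -> b <= expR x -> c <= expR (x + x).
  move=> b0 cb bx; rewrite expRD (le_trans cb)// ler_pM//.
have h : 1 + 1 / 16%:R <= expR (1 / 16%:R : R) by exact: expR_ge1Dx.
have h2 : 1128%:R / 1000%:R <= expR (1 / 16%:R + 1 / 16%:R : R).
  by apply: sq h; lra.
have h4 := sq _ _ (1272%:R / 1000%:R) _ _ h2.
have {}h4 := h4 ltac:(lra) ltac:(lra).
have h8 := sq _ _ (1617%:R / 1000%:R) _ _ h4.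
have {}h8 := h8 ltac:(lra) ltac:(lra).
have h16 := sq _ _ (2614%:R / 1000%:R) _ _ h8.
have {}h16 := h16 ltac:(lra) ltac:(lra).
have e1 : 2614%:R / 1000%:R <= expR (1 : R).
  by apply: le_trans h16 _; rewrite ler_expR; lra.
rewrite expRN -[leRHS]invrK lef_pV2 ?posrE ?expR_gt0 ?invr_gt0 ?divr_gt0//.
rewrite invf_div; lra.
Qed.

Section Threshold.
Context {R : realType}.
Variables (n k : nat).
Hypotheses (hk : (3 <= k)%N) (n0 : (0 < n)%N).
Implicit Types z : R.

Let m := 'C(k, 2).
Let c : R := n%:R `^ (2%:R / (k%:R - 1)).

Lemma natr_bin2 : m%:R * 2%:R = k%:R * (k%:R - 1) :> R.
Proof.
by have /(congr1 (fun i => i%:R : R)) := double_bin2 k; rewrite natrD !natrM -/m => h; lra.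
Qed.

Lemma natr_k_gt2 : 2%:R < k%:R :> R. Proof. by rewrite ltr_nat. Qed.

Lemma natr_bin2_gt0 : 0 < m%:R :> R. Proof. by rewrite ltr0n bin_gt0 ltnW. Qed.

Lemma scale_gt0 : 0 < c. Proof. by apply: powR_gt0; rewrite ltr0n. Qed.

Lemma natr_powD (r s : R) : n%:R `^ (r + s) = n%:R `^ r * n%:R `^ s :> R.
Proof. by rewrite powRD//; apply/implyP => _; rewrite pnatr_eq0 -lt0n. Qed.

Lemma scale_exp_m : c ^+ m = n%:R ^+ k.
Proof.
rewrite -powR_mulrn ?powR_ge0// -powRrM -powR_mulrn//; congr (_ `^ _).
have k2 := natr_k_gt2; have m2 := natr_bin2.
rewrite mulrAC [2%:R * _]mulrC m2; field; lra.
Qed.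

Lemma scale_exp_mk : c ^+ (m + k.-1) = n%:R ^+ k.+2.
Proof.
have k1 : c ^+ k.-1 = n%:R ^+ 2.
  rewrite -powR_mulrn ?powR_ge0// -powRrM -powR_mulrn//; congr (_ `^ _).
  have k2 := natr_k_gt2.
  have -> : (k.-1)%:R = k%:R - 1 :> R by rewrite -subn1 natrB// ltnW// ltnW.
  field; lra.
by rewrite exprD scale_exp_m k1 -exprD addn2.
Qed.

(** Divide by [c] and use [1/m = 2/(k - 1) - 2/k]. *)
Lemma threshold_bounds z :
  z <= Num.min (n%:R `^ (m%:R^-1))
     (c * expR (- ((k%:R - 1) / (k%:R - 2%:R)))) <->
  threshold n k z <= Num.min (n%:R `^ (- (2%:R / k%:R)))
     (expR (- ((k%:R - 1) / (k%:R - 2%:R)))).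
Proof.
have c0 := scale_gt0.
suff -> : n%:R `^ (m%:R^-1) = c * n%:R `^ (- (2%:R / k%:R)).
  by rewrite /threshold -/c !le_min !ler_pdivrMr// ![_ * c]mulrC.
rewrite -natr_powD; congr (_ `^ _).
have k2 := natr_k_gt2; have m0 := natr_bin2_gt0; have m2 := natr_bin2.
have -> : m%:R = k%:R * (k%:R - 1) / 2%:R :> R by lra.
by field; rewrite !gt_eqF//; lra.
Qed.

Lemma threshold_ge0 z : 0 <= z -> 0 <= threshold n k z.
Proof. by move=> z0; rewrite divr_ge0// powR_ge0. Qed.

Lemma threshold_pow_le1 z : 0 <= z ->
  threshold n k z <= n%:R `^ (- (2%:R / k%:R)) ->
  n%:R ^+ 2 * threshold n k z ^+ k <= 1.
Proof.
move=> z0 zle; have N0 : 0 < n%:R :> R by rewrite ltr0n.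
have e : 1 = n%:R ^+ 2 * (n%:R `^ (- (2%:R / k%:R))) ^+ k :> R.
  rewrite -[X in _ * X]powR_mulrn ?powR_ge0// -powRrM -[X in X * _]powR_mulrn// -natr_powD.
  rewrite (_ : _ + _ = 0) ?powRr0//.
  by have k2 := natr_k_gt2; field; lra.
by rewrite [leRHS]e ler_wpM2l// lerXn2r ?nnegrE ?threshold_ge0 ?powR_ge0.
Qed.

Lemma expR_cutoff_le : expR (- ((k%:R - 1) / (k%:R - 2%:R))) <= 27%:R / 70%:R :> R.
Proof.
apply: le_trans expR_N1_le; have k2 := natr_k_gt2.
by rewrite ler_expR lerN2 ler_pdivlMr; lra.
Qed.

(** The scale contributes [n ^ (k + 2)] to the denominator against [n ^ (k + 1)] above, which leaves
    the single factor [1/n]. *)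
Lemma overlap_bound_threshold z :
  overlap_bound n k (threshold n k z) =
  z ^+ (m + k.-1) / n%:R / (m`!%:R * (k.-1)`!%:R ^+ 2).
Proof.
have N0 : n%:R != 0 :> R by rewrite pnatr_eq0 -lt0n.
rewrite /overlap_bound; congr (_ / _).
by rewrite /threshold -/c expr_div_n scale_exp_mk (exprS _ k.+1); field; rewrite ?N0 ?expf_neq0.
Qed.

Lemma lambda_ratio z : 0 < z ->
  lambda n k z / (z ^+ m / (k`!%:R * m`!%:R)) = (n ^_ k)%:R / n%:R ^+ k.
Proof.
move=> z0; have N0 : n%:R != 0 :> R by rewrite pnatr_eq0 -lt0n.
rewrite -bin_ffact natrM /lambda /threshold -/c expr_div_n scale_exp_m -/m; field.
by rewrite !expf_neq0 ?gt_eqF ?ltr0n ?fact_gt0.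
Qed.

End Threshold.

(** * Asymptotics of [lambda] and the final bound *)

Lemma cvg_ffact_ratio {R : realType} (k : nat) :
  ((n ^_ k)%:R / n%:R ^+ k : R) @[n --> \oo] --> (1 : R).
Proof.
elim: k => [|k IH].
  by under eq_fun do rewrite ffactn0 expr0 divr1; exact: cvg_cst.
have key : ((n - k)%:R / n%:R : R) @[n --> \oo] --> (1 : R).
  (* After the shift by one the ratio equals [1 - k * harmonic n] for large [n], as [harmonic n] is
     [1/(n + 1)]. *)
  rewrite -(cvg_shiftS (fun n => (n - k)%:R / n%:R : R)).
  have h : (1 - k%:R * harmonic n : R) @[n --> \oo] --> (1 - k%:R * 0 : R).
    by apply: cvgB; [exact: cvg_cst|apply: cvgM; [exact: cvg_cst|exact: cvg_harmonic]].
  rewrite mulr0 subr0 in h; apply: cvg_trans h; apply: near_eq_cvg.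
  near=> n; rewrite /harmonic /= natrB; last by near: n; exists k => // j /= kj; exact: leqW.
  by rewrite mulrBl divff// pnatr_eq0.
have h : ((n ^_ k)%:R / n%:R ^+ k * ((n - k)%:R / n%:R) : R) @[n --> \oo] --> (1 * 1 : R).
  exact: cvgM IH key.
rewrite mulr1 in h; apply: cvg_trans h.
apply: near_eq_cvg; near=> n; rewrite /= ffactnSr natrM exprSr invfM mulrACA//.
Unshelve. all: by end_near. Qed.

Theorem theorem2 (R : realType) (k : nat) (hk : (3 <= k)%N) :
  (forall z : nat -> R, (forall n, 0 < z n) ->
     lambda n k (z n) / (z n ^+ 'C(k, 2) / (k`!%:R * ('C(k, 2)`!)%:R))
       @[n --> \oo] --> (1 : R)) /\
  (forall (n : nat) (d : measure_display) (T : measurableType d)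
     (P : probability T R) (X : edge n -> {RV P >-> R}) (z : R),
   (k <= n)%N ->
   (forall e : edge n, uniform01 (X e)) ->
   mutually_independent X ->
   0 <= z ->
   let m := 'C(k, 2) in
   let w := threshold n k z in
   let bound_z :=
     z <= Num.min (n%:R `^ (m%:R^-1))
            (n%:R `^ (2%:R / (k%:R - 1)) *
               expR (- ((k%:R - 1) / (k%:R - 2%:R)))) in
   let bound_w :=
     w <= Num.min (n%:R `^ (- (2%:R / k%:R)))
            (expR (- ((k%:R - 1) / (k%:R - 2%:R)))) in
   (bound_z <-> bound_w) /\
   (bound_z ->
    (`| P [set t | w%:E <= min_clique_weight k (fun e => X e t)]
        - (expR (- lambda n k z))%:E |
     <= (8%:R / 7%:R * ((k%:R - 2%:R) / ((m`!)%:R * ((k.-1)`!)%:R ^+ 2))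
          * (z ^+ (m + k.-1) / n%:R))%:E)%E)).
Proof.
split=> [z z0|n d T P X z kn unifX indX z0 m w bound_z bound_w].
  apply: cvg_trans (cvg_ffact_ratio k); apply: near_eq_cvg; near=> n.
  by rewrite /= lambda_ratio//; near: n; exists 1%N.
have n0 : (0 < n)%N by apply: leq_trans kn; apply: leq_trans hk.
have zw : bound_z <-> bound_w by exact: threshold_bounds.
split=> // /zw; rewrite /bound_w le_min => /andP[wn we].
have w0 : 0 <= w by exact: threshold_ge0.
have wb : w <= 27%:R / 70%:R by apply: le_trans we (expR_cutoff_le hk).
have w1 : w <= 1 by apply: le_trans wb _; lra.
have nw := threshold_pow_le1 hk n0 z0 wn.
have := clique_poisson indX unifX hk kn w0 w1 nw wb.
rewrite mulrA -/(lambda n k z) overlap_bound_threshold// => h.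
rewrite -[X in `|X - _|%E]fineK; last first.
  by rewrite fin_num_measure//; exact: measurable_min_clique_weight_ge.
rewrite -EFinB abse_EFin lee_fin; apply: le_trans h _.
rewrite le_eqVlt; apply/orP; left; apply/eqP; ring.
Unshelve. all: by end_near. Qed.
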